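(* The realizability disjunction connective $X_1\mathbin{\wp}X_2$, defined as the second-order formula $\exists Y.\,(\neg Y\rightarrow X_1)\wedge(\neg\neg Y\rightarrow X_2)$, is not definable by a quantifier-free schema in intuitionistic propositional logic: there is no quantifier-free formula $\Psi(X_1,X_2)$ such that both $X_1\mathbin{\wp}X_2\vdash\Psi(X_1,X_2)$ and $\Psi(X_1,X_2)\vdash X_1\mathbin{\wp}X_2$ are derivable.
   Context: Formulas of second-order intuitionistic propositional logic are built from propositional variables and $\bot$ using $\wedge,\vee,\rightarrow$ and the propositional quantifiers $\forall X,\exists X$; $\neg A$ abbreviates $A\rightarrow\bot$. $\Gamma\vdash A$ denotes derivability in the standard Gentzen-style intuitionistic sequent calculus for this language (quantifiers may be instantiated by arbitrary formulas). $\Psi(X_1,X_2)$ contains only the variables $X_1,X_2$. *)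

(* Defs.v *)
From Stdlib Require Import List Permutation.
Import ListNotations.

Set Implicit Arguments.

(** Second-order propositional formulas with de Bruijn indices: [All A] and
    [Ex A] bind index 0 of [A]; an index beyond the enclosing binders is a free
    propositional variable. *)
Inductive form : Type :=
| Var (n : nat)
| Bot
| And (A B : form)
| Or (A B : form)
| Imp (A B : form)
| All (A : form)
| Ex (A : form).

Definition Neg (A : form) : form := Imp A Bot.

Definition up_ren (f : nat -> nat) (n : nat) : nat :=
  match n with 0 => 0 | S k => S (f k) end.

Fixpoint rename (f : nat -> nat) (A : form) : form :=
  match A with
  | Var n => Var (f n)
  | Bot => Bot
  | And B C => And (rename f B) (rename f C)
  | Or B C => Or (rename f B) (rename f C)
  | Imp B C => Imp (rename f B) (rename f C)
  | All B => All (rename (up_ren f) B)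
  | Ex B => Ex (rename (up_ren f) B)
  end.

Definition shift (A : form) : form := rename S A.

Definition up_sub (s : nat -> form) (n : nat) : form :=
  match n with 0 => Var 0 | S k => shift (s k) end.

Fixpoint subst (s : nat -> form) (A : form) : form :=
  match A with
  | Var n => s n
  | Bot => Bot
  | And B C => And (subst s B) (subst s C)
  | Or B C => Or (subst s B) (subst s C)
  | Imp B C => Imp (subst s B) (subst s C)
  | All B => All (subst (up_sub s) B)
  | Ex B => Ex (subst (up_sub s) B)
  end.

(** [inst A B] is the capture-avoiding instance [A[B/X]] of the body [A] of a
    quantifier binding [X]; the remaining indices of [A] are lowered by one. *)
Definition inst (A B : form) : form :=
  subst (fun n => match n with 0 => B | S k => Var k end) A.

(** Gentzen's LJ with second-order quantifier rules.  Since [Bot] is primitive,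
    every succedent is exactly one formula.  In [d_allR] and [d_exL] the
    eigenvariable is index 0 of the premise; shifting the other formulas makes
    it fresh for them. *)
Inductive derivable : list form -> form -> Prop :=
| d_ax A : derivable [A] A
| d_cut G D A C :
    derivable G A -> derivable (A :: D) C -> derivable (G ++ D) C
| d_weak G A C : derivable G C -> derivable (A :: G) C
| d_contr G A C : derivable (A :: A :: G) C -> derivable (A :: G) C
| d_exch G D C : Permutation G D -> derivable G C -> derivable D C
| d_botL C : derivable [Bot] C
| d_andR G A B : derivable G A -> derivable G B -> derivable G (And A B)
| d_andL1 G A B C : derivable (A :: G) C -> derivable (And A B :: G) C
| d_andL2 G A B C : derivable (B :: G) C -> derivable (And A B :: G) C
| d_orR1 G A B : derivable G A -> derivable G (Or A B)
| d_orR2 G A B : derivable G B -> derivable G (Or A B)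
| d_orL G A B C :
    derivable (A :: G) C -> derivable (B :: G) C -> derivable (Or A B :: G) C
| d_impR G A B : derivable (A :: G) B -> derivable G (Imp A B)
| d_impL G D A B C :
    derivable G A -> derivable (B :: D) C -> derivable (Imp A B :: G ++ D) C
| d_allR G A : derivable (map shift G) A -> derivable G (All A)
| d_allL G A B C : derivable (inst A B :: G) C -> derivable (All A :: G) C
| d_exR G A B : derivable G (inst A B) -> derivable G (Ex A)
| d_exL G A C :
    derivable (A :: map shift G) (shift C) -> derivable (Ex A :: G) C.

Fixpoint quantifier_free (A : form) : Prop :=
  match A with
  | Var _ | Bot => True
  | And B C | Or B C | Imp B C => quantifier_free B /\ quantifier_free C
  | All _ | Ex _ => False
  end.

Fixpoint occurs_free (x : nat) (A : form) : Prop :=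
  match A with
  | Var n => n = x
  | Bot => False
  | And B C | Or B C | Imp B C => occurs_free x B \/ occurs_free x C
  | All B | Ex B => occurs_free (S x) B
  end.

(** [exists Y, (~ Y -> A) /\ (~ ~ Y -> B)], with [Y] not free in [A] and [B]. *)
Definition rdisj (A B : form) : form :=
  Ex (And (Imp (Neg (Var 0)) (shift A)) (Imp (Neg (Neg (Var 0))) (shift B))).

(* Main.v *)
Require Import Defs.
From Stdlib Require Import List Permutation.
Import ListNotations.

(** The calculus is sound for Kripke frames in which the propositional
    quantifiers range over all upward-closed sets of worlds ([soundness]), and
    there [rdisj] can count leaves while quantifier-free formulas cannot.

    Consider a root below a set of leaves, every variable being true exactly at
    the leaves.  With two leaves the root forces [rdisj X1 X2]: take for [Y] one
    of the leaves, so that [~ Y] and [~ ~ Y] each hold at a single leaf and fail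
    at the root ([fan_two_leaves]).  With one leaf it does not: whatever [Y] is,
    [~ Y] or [~ ~ Y] holds at the root, where [X1] and [X2] both fail
    ([fan_one_leaf]).  Yet identifying the two leaves is a bounded morphism, and
    these preserve the forcing of quantifier-free formulas
    ([bounded_morphism_forces]), so no quantifier-free formula separates the two
    roots. *)

Record frame : Type := Frame {
  world : Type;
  le : world -> world -> Prop;
  le_refl : forall w, le w w;
  le_trans : forall u v w, le u v -> le v w -> le u w
}.

Definition upset (F : frame) (P : world F -> Prop) : Prop :=
  forall w v, le F w v -> P w -> P v.

Definition extend {T : Type} (P : T) (rho : nat -> T) (n : nat) : T :=
  match n with 0 => P | S k => rho k end.

(** The quantifier clauses do not move to later worlds: the domain of upsets is
    the same at every world, so forcing is upward closed already in this form. *)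
Fixpoint forces (F : frame) (rho : nat -> world F -> Prop) (A : form)
    (w : world F) : Prop :=
  match A with
  | Var n => rho n w
  | Bot => False
  | And B C => forces F rho B w /\ forces F rho C w
  | Or B C => forces F rho B w \/ forces F rho C w
  | Imp B C => forall v, le F w v -> forces F rho B v -> forces F rho C v
  | All B => forall P, upset F P -> forces F (extend P rho) B w
  | Ex B => exists P, upset F P /\ forces F (extend P rho) B w
  end.

(** * Soundness *)

Lemma upset_extend (F : frame) P (rho : nat -> world F -> Prop) :
  upset F P -> (forall n, upset F (rho n)) -> forall n, upset F (extend P rho n).
Proof. intros HP Hrho [|n]; simpl; auto. Qed.

Lemma upset_forces (F : frame) (A : form) :
  forall rho, (forall n, upset F (rho n)) -> upset F (forces F rho A).
Proof.
  induction A as [n| |B IHB C IHC|B IHB C IHC|B IHB C IHC|B IHB|B IHB];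
    intros rho Hrho w v Hwv; simpl.
  - apply Hrho, Hwv.
  - trivial.
  - intros [HB HC]; split; [apply (IHB rho Hrho w)|apply (IHC rho Hrho w)]; auto.
  - intros [H|H]; [left; apply (IHB rho Hrho w)|right; apply (IHC rho Hrho w)];
      auto.
  - intros H u Hvu. apply H. exact (le_trans F w v u Hwv Hvu).
  - intros H P HP.
    apply (IHB (extend P rho) (upset_extend F P rho HP Hrho) w); auto.
  - intros [P [HP H]]. exists P. split; [exact HP|].
    apply (IHB (extend P rho) (upset_extend F P rho HP Hrho) w); auto.
Qed.

(** The valuations are related by pointwise equivalence rather than by a
    composition, so that the induction passes under binders without
    extensionality axioms; likewise in [forces_subst]. *)
Lemma forces_rename (F : frame) (A : form) :
  forall f (rho rho' : nat -> world F -> Prop),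
  (forall n w, rho (f n) w <-> rho' n w) ->
  forall w, forces F rho (rename f A) w <-> forces F rho' A w.
Proof.
  assert (Hup : forall P f (rho rho' : nat -> world F -> Prop),
    (forall n w, rho (f n) w <-> rho' n w) ->
    forall n w, extend P rho (up_ren f n) w <-> extend P rho' n w).
  { intros P f rho rho' H [|n] w; simpl; [reflexivity|apply H]. }
  induction A as [n| |B IHB C IHC|B IHB C IHC|B IHB C IHC|B IHB|B IHB];
    intros f rho rho' H w; simpl.
  - apply H.
  - reflexivity.
  - rewrite (IHB f rho rho' H w), (IHC f rho rho' H w). reflexivity.
  - rewrite (IHB f rho rho' H w), (IHC f rho rho' H w). reflexivity.
  - split; intros K v Hv HB; apply (IHC f rho rho' H), K, (IHB f rho rho' H);
      assumption.
  - split; intros K P HP; apply (IHB _ _ _ (Hup P f rho rho' H)), K, HP.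
  - split; intros [P [HP K]]; exists P;
      (split; [exact HP|apply (IHB _ _ _ (Hup P f rho rho' H)), K]).
Qed.

Lemma forces_shift (F : frame) (A : form) P (rho : nat -> world F -> Prop) w :
  forces F (extend P rho) (shift A) w <-> forces F rho A w.
Proof. apply forces_rename. reflexivity. Qed.

Lemma forces_subst (F : frame) (A : form) :
  forall s (rho rho' : nat -> world F -> Prop),
  (forall n w, forces F rho (s n) w <-> rho' n w) ->
  forall w, forces F rho (subst s A) w <-> forces F rho' A w.
Proof.
  assert (Hup : forall P s (rho rho' : nat -> world F -> Prop),
    (forall n w, forces F rho (s n) w <-> rho' n w) ->
    forall n w, forces F (extend P rho) (up_sub s n) w <-> extend P rho' n w).
  { intros P s rho rho' H [|n] w; simpl; [reflexivity|].
    rewrite forces_shift. apply H. }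
  induction A as [n| |B IHB C IHC|B IHB C IHC|B IHB C IHC|B IHB|B IHB];
    intros s rho rho' H w; simpl.
  - apply H.
  - reflexivity.
  - rewrite (IHB s rho rho' H w), (IHC s rho rho' H w). reflexivity.
  - rewrite (IHB s rho rho' H w), (IHC s rho rho' H w). reflexivity.
  - split; intros K v Hv HB; apply (IHC s rho rho' H), K, (IHB s rho rho' H);
      assumption.
  - split; intros K P HP; apply (IHB _ _ _ (Hup P s rho rho' H)), K, HP.
  - split; intros [P [HP K]]; exists P;
      (split; [exact HP|apply (IHB _ _ _ (Hup P s rho rho' H)), K]).
Qed.

(** The truth set of [B] is itself an upset, hence a legitimate value of the
    quantified variable; this is what makes the impredicative instances sound. *)
Lemma forces_inst (F : frame) (A B : form) (rho : nat -> world F -> Prop) w :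
  forces F rho (inst A B) w <-> forces F (extend (forces F rho B) rho) A w.
Proof. apply forces_subst. intros [|n] v; reflexivity. Qed.

Lemma forces_context_shift (F : frame) P (rho : nat -> world F -> Prop) G w :
  Forall (fun A => forces F rho A w) G ->
  Forall (fun A => forces F (extend P rho) A w) (map shift G).
Proof.
  intros H. apply Forall_map. revert H. apply Forall_impl.
  intros A. apply forces_shift.
Qed.

Theorem soundness (F : frame) (G : list form) (C : form) :
  derivable G C ->
  forall rho, (forall n, upset F (rho n)) ->
  forall w, Forall (fun A => forces F rho A w) G -> forces F rho C w.
Proof.
  intros D; induction D as
    [A|G D A C _ IH1 _ IH2|G A C _ IH|G A C _ IH|G D C Hperm _ IH|C
    |G A B _ IH1 _ IH2|G A B C _ IH|G A B C _ IH|G A B _ IH|G A B _ IH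
    |G A B C _ IH1 _ IH2|G A B _ IH|G D A B C _ IH1 _ IH2
    |G A _ IH|G A B C _ IH|G A B _ IH|G A C _ IH]; intros rho Hrho w HG.
  - exact (Forall_inv HG).
  - apply Forall_app in HG as [HG HD]. auto.
  - exact (IH rho Hrho w (Forall_inv_tail HG)).
  - apply IH; auto. constructor; [exact (Forall_inv HG)|exact HG].
  - apply IH; auto.
    exact (Permutation_Forall (Permutation_sym Hperm) HG).
  - destruct (Forall_inv HG).
  - split; auto.
  - apply IH; auto. apply Forall_cons_iff in HG as [[HA HB] HG'].
    constructor; assumption.
  - apply IH; auto. apply Forall_cons_iff in HG as [[HA HB] HG'].
    constructor; assumption.
  - left; auto.
  - right; auto.
  - apply Forall_cons_iff in HG as [[HA|HB] HG']; auto.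
  - intros v Hwv HA. apply IH; auto. constructor; [exact HA|].
    revert HG. apply Forall_impl. intros E. apply upset_forces; assumption.
  - apply Forall_cons_iff in HG as [HAB HGD]. apply Forall_app in HGD as [HG HD].
    apply IH2; auto. constructor; [|exact HD].
    apply HAB; [apply le_refl|exact (IH1 rho Hrho w HG)].
  - intros P HP. apply IH.
    + apply upset_extend; assumption.
    + apply forces_context_shift, HG.
  - apply Forall_cons_iff in HG as [HA HG']. apply IH; auto.
    constructor; [|exact HG'].
    apply forces_inst, HA, upset_forces, Hrho.
  - exists (forces F rho B). split; [apply upset_forces, Hrho|].
    apply forces_inst; auto.
  - apply Forall_cons_iff in HG as [[P [HP HA]] HG'].
    apply (forces_shift F C P), IH.
    + apply upset_extend; assumption.
    + constructor; [exact HA|]. apply forces_context_shift, HG'.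
Qed.

(** * Bounded morphisms *)

(** An implication refers to all later worlds: monotonicity of [f] transfers it
    from [F'] to [F], and the back condition from [F] to [F'].  A quantifier
    would break this, since not every upset of [F] is a preimage under [f]. *)
Lemma bounded_morphism_forces (F F' : frame) (f : world F -> world F')
    (rho : nat -> world F -> Prop) (rho' : nat -> world F' -> Prop)
    (f_mono : forall w v, le F w v -> le F' (f w) (f v))
    (f_back : forall w v', le F' (f w) v' -> exists v, le F w v /\ f v = v')
    (f_rho : forall n w, rho n w <-> rho' n (f w)) (A : form) :
  quantifier_free A -> forall w, forces F rho A w <-> forces F' rho' A (f w).
Proof.
  induction A as [n| |B IHB C IHC|B IHB C IHC|B IHB C IHC|B IHB|B IHB];
    simpl; intros Hqf w; try contradiction.
  - apply f_rho.
  - reflexivity.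
  - destruct Hqf as [HB HC]. rewrite (IHB HB w), (IHC HC w). reflexivity.
  - destruct Hqf as [HB HC]. rewrite (IHB HB w), (IHC HC w). reflexivity.
  - destruct Hqf as [HB HC]. split.
    + intros K v' Hv' KB. destruct (f_back w v' Hv') as [v [Hv <-]].
      apply IHC, K, IHB; assumption.
    + intros K v Hv KB. apply IHC, K, IHB; auto.
Qed.

(** * Fans *)

(** [None] is the root and [Some l] the leaf [l]. *)
Definition fan_le (L : Type) (w v : option L) : Prop := w = None \/ w = v.

Definition fan (L : Type) : frame.
Proof.
  refine (Frame (option L) (fan_le L) _ _).
  - intros w. right. reflexivity.
  - intros u v w [-> | ->] H; [left; reflexivity|exact H].
Defined.

Definition at_leaves (L : Type) (n : nat) (w : world (fan L)) : Prop :=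
  w <> None.

Lemma at_leaves_upset (L : Type) (n : nat) : upset (fan L) (at_leaves L n).
Proof. intros w v [-> | ->] H; [destruct (H eq_refl)|exact H]. Qed.

Lemma fan_two_leaves (X1 X2 : nat) :
  forces (fan bool) (at_leaves bool) (rdisj (Var X1) (Var X2)) None.
Proof.
  exists (fun w => w = Some true). split.
  - intros w v [-> | ->] H; [discriminate|exact H].
  - split; intros v _ H ->.
    + (* The root does not force [~ Y]: it sees the leaf [true] in [Y]. *)
      apply (H (Some true)); [left|]; reflexivity.
    + (* Nor does it force [~ ~ Y]: at the leaf [false], [~ Y] holds. *)
      apply (H (Some false)); [left; reflexivity|].
      intros u [Hu | <-]; discriminate.
Qed.

Lemma fan_one_leaf (X1 X2 : nat) :
  ~ forces (fan unit) (at_leaves unit) (rdisj (Var X1) (Var X2)) None.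
Proof.
  intros [P [HP [H1 H2]]].
  (* If the leaf is not in [Y], then neither is the root, so [~ Y] holds at the
     root and would give [X1] there. *)
  assert (HY : ~ ~ P (Some tt)).
  { intros HnP. apply (H1 None); [left; reflexivity| |reflexivity].
    intros v _ Hv. apply HnP, (HP v); [|exact Hv].
    destruct v as [[]|]; [right|left]; reflexivity. }
  (* Every world sees the leaf, so [~ Y] fails everywhere; thus [~ ~ Y] holds at
     the root and gives [X2] there. *)
  apply (H2 None); [left; reflexivity| |reflexivity].
  intros v _ Hv. apply HY. intros Htt. apply (Hv (Some tt)); [|exact Htt].
  destruct v as [[]|]; [right|left]; reflexivity.
Qed.

Theorem mainTheorem3 (X1 X2 : nat) (hX : X1 <> X2) :
  ~ (exists Psi : form,
       quantifier_free Psi /\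
       (forall x : nat, occurs_free x Psi -> x = X1 \/ x = X2) /\
       derivable [rdisj (Var X1) (Var X2)] Psi /\
       derivable [Psi] (rdisj (Var X1) (Var X2))).
Proof.
  intros [Psi [Hqf [_ [Hto Hfrom]]]].
  apply (fan_one_leaf X1 X2).
  apply (soundness (fan unit) _ _ Hfrom _ (at_leaves_upset unit)).
  constructor; [|constructor].
  apply (bounded_morphism_forces (fan bool) (fan unit)
           (option_map (fun _ => tt)) (at_leaves bool) (at_leaves unit))
    with (w := None); try exact Hqf.
  - intros w v [-> | ->]; [left|right]; reflexivity.
  - intros [l|] v' [Hv' | <-]; try discriminate.
    + exists (Some l). split; [right|]; reflexivity.
    + (* Both leaves are above the root, so either one can be the preimage. *)
      destruct v' as [[]|]; [exists (Some true)|exists None];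
        (split; [left|]; reflexivity).
    + exists None. split; [left|]; reflexivity.
  - intros n [l|]; unfold at_leaves; simpl; split; congruence.
  - apply (soundness (fan bool) _ _ Hto _ (at_leaves_upset bool)).
    constructor; [|constructor]. apply fan_two_leaves.
Qed.
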